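(* Let $a\ge 2$, $c>0$, $d$ be integers with $d<ca$ and $\gcd(d,a)=\gcd(d,c)=1$, let $n\ge 1$, and let $\mathbf s_j=ca^{n+j}-d$ for $j\in\mathbb N$ and $S_n=\langle\{\mathbf s_j:j\in\mathbb N\}\rangle$. Let $m=e(S_n)$, assume $m\ge 2$, and let $\lambda=\gcd(S_n)$. Let $(\alpha_1,\ldots,\alpha_{m-1})$ be the unique residual $(m-1)$-tuple such that $\mathbf s_0/\lambda=1+\sum_{j=1}^{m-1}\alpha_j\mathbf R_j$ (such a tuple exists and is unique), and assume that $\mathbf R_m\le\mathbf s_1/\lambda$. Then $$\mathrm{Ap}(S_n,\mathbf s_0)=\left\{\sum_{j=1}^{m-1}\beta_j\mathbf s_j:(\beta_1,\ldots,\beta_{m-1})\in A(m-1),\ (\beta_1,\ldots,\beta_{m-1})\le_c(\alpha_1,\ldots,\alpha_{m-1})\right\}.$$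
   Context: $\mathbb N=\{0,1,2,\ldots\}$. For $A\subseteq\mathbb N$, $\langle A\rangle$ is the submonoid of $(\mathbb N,+)$ generated by $A$. For a nontrivial submonoid $M$ of $\mathbb N$, the minimal generating set of $M$ is the unique generating set contained in every generating set of $M$ (its elements are the nonzero elements of $M$ that are not sums of two nonzero elements of $M$; it is finite), and $e(M)$ is its cardinality. $\gcd(M)$ denotes the greatest common divisor of all elements of $M$. For $x\in M\setminus\{0\}$, the Apéry set is $\mathrm{Ap}(M,x)=\{y\in M: y-x\notin M\}$. The repunit numbers in base $a$ are $\mathbf R_0=0$ and $\mathbf R_k=1+a+\cdots+a^{k-1}$ for $k\ge1$. For $r\ge 1$, a residual $r$-tuple (with respect to $a$) is a tuple of integers $(\alpha_1,\ldots,\alpha_r)$ such that (1) $0\le\alpha_i\le a$ for all $i$, and (2) if $\alpha_{i_0}=a$ for some $i_0\in\{2,\ldots,r\}$ then $\alpha_i=0$ for all $i\in\{1,\ldots,i_0-1\}$. $A(r)$ is the set of all residual $r$-tuples. The co-lexicographic order: $(\alpha_1,\ldots,\alpha_r)\le_c(\beta_1,\ldots,\beta_r)$ if the tuples are equal or there is $t\in\{1,\ldots,r\}$ with $\alpha_t<\beta_t$ and $\alpha_j=\beta_j$ for all $j=t+1,\ldots,r$. *)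

(* Defs.v *)
From HB Require Import structures.
From mathcomp Require Import all_boot all_order all_algebra.
From mathcomp Require Import finmap.
From mathcomp Require Import boolp classical_sets functions cardinality.

Set Implicit Arguments.
Unset Strict Implicit.
Unset Printing Implicit Defensive.

Import Order.TTheory GRing.Theory Num.Theory.

Local Open Scope classical_set_scope.
Local Open Scope nat_scope.

Definition is_submonoid (M : set nat) : Prop :=
  M 0 /\ forall x y, M x -> M y -> M (x + y).

Definition submonoid_gen (A : set nat) : set nat := smallest is_submonoid A.

Definition is_min_gen_set (M A : set nat) : Prop :=
  submonoid_gen A = M /\ forall B, submonoid_gen B = M -> A `<=` B.

(* [is_min_gen_set M] holds of exactly one set when [M] is a submonoid
   ([is_min_gen_set_atoms] below), so the default value is not used then. *)
Definition min_gen_set (M : set nat) : set nat := xget set0 (is_min_gen_set M).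

(* [fset_set] is empty on infinite sets; minimal generating sets of
   submonoids of [nat] are finite. *)
Definition embdim (M : set nat) : nat := #|` fset_set (min_gen_set M)|%fset.

Definition is_set_gcd (M : set nat) (g : nat) : Prop :=
  (forall x, M x -> g %| x) /\
  (forall h, (forall x, M x -> h %| x) -> h %| g).

Definition set_gcd (M : set nat) : nat := xget 0 (is_set_gcd M).

(* The subtraction on [nat] is truncated, hence the guard [x <= y]. *)
Definition apery (M : set nat) (x : nat) : set nat :=
  [set y | M y /\ ~ (x <= y /\ M (y - x))].

Definition repunit (a k : nat) : nat := \sum_(i < k) a ^ i.

(* Tuples are indexed from 0: [tnth alpha i] is the coordinate of index
   [i.+1]. *)
Definition residual (a r : nat) : set (r.-tuple nat) :=
  [set alpha | (forall i, tnth alpha i <= a) /\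
     (forall i0 : 'I_r, 0 < i0 -> tnth alpha i0 = a ->
        forall i : 'I_r, i < i0 -> tnth alpha i = 0)].

Definition colex_le (r : nat) (alpha beta : r.-tuple nat) : Prop :=
  alpha = beta \/
  exists t : 'I_r, tnth alpha t < tnth beta t /\
    forall j : 'I_r, t < j -> tnth alpha j = tnth beta j.

(* The absolute value only serves to land in [nat]: see [sE]. *)
Definition s (a c : nat) (d : int) (n j : nat) : nat :=
  absz (c%:Z * a%:Z ^+ (n + j) - d)%R.

Definition S_ (a c : nat) (d : int) (n : nat) : set nat :=
  submonoid_gen (range (s a c d n)).

Lemma sE (a c : nat) (d : int) (n j : nat) :
  2 <= a -> 1 <= n -> (d < c%:Z * a%:Z)%R ->
  0 < s a c d n j /\ Posz (s a c d n j) = (c%:Z * a%:Z ^+ (n + j) - d)%R.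
Proof.
move=> a2 n1 hd.
have h : (c%:Z * a%:Z <= c%:Z * a%:Z ^+ (n + j))%R.
  rewrite ler_wpM2l// -{1}[Posz a]expr1 ler_weXn2l//; last first.
    by rewrite (leq_trans n1)// leq_addr.
  by rewrite lez_nat ltnW.
have h0 : (0 < c%:Z * a%:Z ^+ (n + j) - d)%R.
  by rewrite subr_gt0 (lt_le_trans hd).
by split; [rewrite absz_gt0 gt_eqF|rewrite /s gez0_abs// ltW].
Qed.

Lemma is_min_gen_set_atoms (M : set nat) : is_submonoid M ->
  is_min_gen_set M [set x | [/\ M x, x != 0 &
    ~ exists y z, [/\ M y, M z, y != 0, z != 0 & x = y + z]]].
Proof.
move=> Msub; set A := (X in is_min_gen_set M X); split.
  apply/seteqP; split=> [x Ax|x]; first by apply: Ax; split=> // y [].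
  elim/ltn_ind: x => x IH Mx N [Nsub AN].
  have [->|x0] := eqVneq x 0; first exact: Nsub.1.
  have [[y [z [My Mz y0 z0 E]]]|nx] :=
    pselect (exists y z, [/\ M y, M z, y != 0, z != 0 & x = y + z]).
    rewrite E; apply: Nsub.2; apply: IH => //.
      by rewrite E -[X in X < _]addn0 ltn_add2l lt0n.
    by rewrite E -[X in X < _]add0n ltn_add2r lt0n.
  by apply: AN; split.
move=> B BM x [Mx x0 nx]; apply: contrapT => nBx.
have BsM : B `<=` M by rewrite -BM; exact: sub_gen_smallest.
suff /(_ x) MMx : M `<=` M `\ x by have [_] := MMx Mx; apply.
rewrite -{1}BM; apply: smallest_sub; last first.
  by move=> y By; split; [exact: BsM|move=> /= yx; apply: nBx; rewrite -yx].
split; first by split; [exact: Msub.1|move=> /= E; rewrite -E eqxx in x0].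
move=> y z [My yx] [Mz zx]; split; first exact: Msub.2.
move=> /= E; apply: nx; exists y, z; split=> //.
  by apply/eqP => y0; apply: zx; rewrite -E y0.
by apply/eqP => z0; apply: yx; rewrite -E z0 addn0.
Qed.

(* Main.v *)
(** Writing [R_j] for the repunits, [s_j = s_0 + D R_j] with
    [D = c a^n (a - 1)], and [lambda = gcd(s_0, D)]; put [q = s_0 / lambda] and
    [k = D / lambda], which are coprime.  A sum of generators with index
    multiset [l] is thus determined by its size and its weight
    [sum_(i in l) R_i], and its class modulo [s_0] by the weight modulo [q].
    The identity [a R_j + R_i = R_(j+1) + a R_(i-1)] ([1 <= i <= j]) preserves
    size and weight, while [q <= R_m <= q + k] gives identities that trade [q]
    units of weight for [k] copies of [s_0].  Applying them as long as possible,
    every element of [S_n] becomes a multiple of [s_0] plus a residual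
    combination of [s_1, ..., s_(m-1)] of weight less than [q].  On residual
    tuples the colexicographic order is the order of the weights, so these
    combinations represent each class modulo [s_0] exactly once. *)

Require Import Defs.
From HB Require Import structures.
From mathcomp Require Import all_boot all_order all_algebra.
From mathcomp Require Import finmap.
From mathcomp Require Import boolp classical_sets functions cardinality.
From mathcomp Require Import zify ring.

Set Implicit Arguments.
Unset Strict Implicit.
Unset Printing Implicit Defensive.

Import Order.TTheory GRing.Theory Num.Theory.

Local Open Scope classical_set_scope.
Local Open Scope nat_scope.

(** * Repunit identities *)

Lemma repunitS (a k : nat) : repunit a k.+1 = a * repunit a k + 1.
Proof.
rewrite /repunit big_ord_recl expn0 big_distrr addnC; congr (_ + _).
by apply: eq_bigr => i _; rewrite /= expnS.
Qed.

Lemma repunit0 (a : nat) : repunit a 0 = 0.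
Proof. by rewrite /repunit big_ord0. Qed.

Lemma repunit1 (a : nat) : repunit a 1 = 1.
Proof. by rewrite repunitS repunit0 muln0. Qed.

(** The lowest [i] terms of the geometric sum split off. This is what rewrites indices [j >= m]
    through [R_m]. *)
Lemma repunitD (a k i : nat) :
  repunit a (k + i) = a ^ i * repunit a k + repunit a i.
Proof.
elim: i => [|i IH]; first by rewrite addn0 repunit0 expn0 mul1n addn0.
by rewrite addnS !repunitS IH expnS mulnDr mulnA addnA.
Qed.

Lemma repunit_subn1 (a k : nat) :
  0 < a -> (a - 1) * repunit a k + 1 = a ^ k.
Proof.
case: a => // a _; rewrite subn1 /=; elim: k => [|k IH].
  by rewrite repunit0 muln0.
by rewrite repunitS expnS -IH; ring.
Qed.

(** * Weights of residual tuples and the colexicographic order *)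

(* [residual] for functions, so that the length can vary in inductions. *)
Definition residual_on (a r : nat) (b : nat -> nat) : Prop :=
  (forall i, i < r -> b i <= a) /\
  (forall i j, i < j -> j < r -> b j = a -> b i = 0).

Lemma residual_onW (a r r' : nat) (b : nat -> nat) :
  r' <= r -> residual_on a r b -> residual_on a r' b.
Proof.
move=> rr [ba b0]; split=> [i ir|i j ij jr]; first exact/ba/(leq_trans ir).
exact/b0/(leq_trans jr).
Qed.

(** If the top digit is [a], all lower digits vanish and the weight is one less than the bound.
    Otherwise, by induction, the lower digits weigh less than one more unit of the top digit. *)
Lemma residual_value_lt (a r : nat) (b : nat -> nat) :
  residual_on a r b -> \sum_(j < r) b j * repunit a j.+1 < repunit a r.+1.
Proof.
rewrite repunitS; elim: r => [|r IH] rb; first by rewrite big_ord0 addn1.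
have [ba b0] := rb; rewrite big_ord_recr /=.
have [bra|bra] := eqVneq (b r) a.
  rewrite big1 ?add0n ?bra ?addn1// => i _.
  by rewrite (b0 i r)// ?mul0n.
have := IH (residual_onW (leqnSn r) rb); rewrite -repunitS.
have {}bra : b r < a by rewrite ltn_neqAle bra ba.
set x := \sum_(_ < _) _; set y := repunit _ _ => xy.
have : (b r).+1 * y <= a * y by rewrite leq_mul2r bra orbT.
rewrite mulSn; lia.
Qed.

(** One extra unit at the highest differing index outweighs all the digits of [b] below it, by
    [residual_value_lt]. *)
Lemma colex_value_lt (a r t : nat) (b b' : nat -> nat) :
  residual_on a r b -> t < r -> b t < b' t ->
  (forall j, t < j -> j < r -> b j = b' j) ->
  \sum_(j < r) b j * repunit a j.+1 < \sum_(j < r) b' j * repunit a j.+1.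
Proof.
elim: r => // r IH rb; rewrite ltnS leq_eqVlt !big_ord_recr /=.
have {}rb := residual_onW (leqnSn r) rb.
case/predU1P=> [->|tr] bt bb'.
  have := residual_value_lt rb; set x := \sum_(_ < _) _.
  set z := \sum_(_ < _) _; set y := repunit _ _ => xy.
  have : (b r).+1 * y <= b' r * y by rewrite leq_mul2r bt orbT.
  rewrite mulSn; lia.
rewrite bb'// ltn_add2r; apply: IH => // j tj jr.
by apply: bb' => //; rewrite ltnW.
Qed.

Lemma last_difference (r : nat) (b b' : nat -> nat) :
  (forall j, j < r -> b j = b' j) \/
  exists t, [/\ t < r, b t != b' t &
    forall j, t < j -> j < r -> b j = b' j].
Proof.
elim: r => [|r IH]; first by left.
have [brr|brr] := eqVneq (b r) (b' r); last first.
  by right; exists r; split=> // j rj; rewrite ltnS leqNgt rj.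
case: IH => [bb'|[t [tr bt bb']]]; [left|right].
  by move=> j; rewrite ltnS leq_eqVlt => /predU1P[->|/bb'].
exists t; split=> [||j tj]; [exact: ltnW|by []|].
by rewrite ltnS leq_eqVlt => /predU1P[->|/bb'->].
Qed.

Lemma residual_tnth (a r : nat) (b : r.-tuple nat) :
  residual a b -> residual_on a r (nth 0 b).
Proof.
move=> [ba b0]; split=> [i ir|i j ij jr bj].
  by have := ba (Ordinal ir); rewrite (tnth_nth 0).
have := b0 (Ordinal jr) _ _ (Ordinal (ltn_trans ij jr)) ij.
by rewrite !(tnth_nth 0) => -> //=; case: j ij {jr bj}.
Qed.

Lemma colex_leP (a r : nat) (b b' : r.-tuple nat) :
  residual a b -> residual a b' ->
  colex_le b b' <->
  \sum_(j < r) tnth b j * repunit a j.+1 <=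
  \sum_(j < r) tnth b' j * repunit a j.+1.
Proof.
have valE (x : r.-tuple nat) : \sum_(j < r) tnth x j * repunit a j.+1 =
    \sum_(j < r) nth 0 x j * repunit a j.+1.
  by apply: eq_bigr => j _; rewrite (tnth_nth 0).
move=> /residual_tnth rb /residual_tnth rb'; rewrite !valE; split.
  case=> [->//|[t [bt bb']]]; apply/ltnW/(@colex_value_lt _ _ t) => //.
    by rewrite -!tnth_nth.
  by move=> j tj jr; have := bb' (Ordinal jr) tj; rewrite !(tnth_nth 0).
case: (last_difference r (nth 0 b) (nth 0 b')) => [bb'|[t [tr bt bb']]] le_bb'.
  by left; apply: eq_from_tnth => j; rewrite !(tnth_nth 0) bb'.
right; exists (Ordinal tr); split; last first.
  by move=> j tj; rewrite !(tnth_nth 0) bb'.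
rewrite !(tnth_nth 0) /= ltnNge; apply/negP => bt'.
have {bt'}bt : nth 0 b' t < nth 0 b t by rewrite ltn_neqAle eq_sym bt.
move: le_bb'; rewrite leqNgt (colex_value_lt rb' tr bt)// => j tj jr.
by rewrite bb'.
Qed.

Lemma residual_value_inj (a r : nat) (b b' : r.-tuple nat) :
  residual a b -> residual a b' ->
  \sum_(j < r) tnth b j * repunit a j.+1 =
  \sum_(j < r) tnth b' j * repunit a j.+1 -> b = b'.
Proof.
move=> rb rb' E.
have /(colex_leP rb rb') [//|[t [bt bb']]] := eq_leq E.
have /(colex_leP rb' rb) [//|[t' [bt' bb'']]] := eq_leq (esym E).
case: (ltngtP t t') => [tt'|tt'|/val_inj tt'].
- by rewrite bb' ?ltnn in bt'.
- by rewrite bb'' ?ltnn in bt.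
- by rewrite -tt' ltnNge ltnW in bt'.
Qed.

(** * Sums over index multisets, represented as lists *)

Lemma perm_nseq_cat (T : eqType) (x : T) (k : nat) (l : seq T) :
  k <= count_mem x l -> exists l', perm_eq l (nseq k x ++ l').
Proof.
elim: k l => [|k IH] l kl; first by exists l.
have xl : x \in l by rewrite -has_pred1 has_count (leq_trans _ kl).
have [|l' ll'] := IH (rem x l).
  by rewrite count_rem xl /= ?eqxx; move: kl; case: count => // k'; rewrite subn1.
exists l'; apply: perm_trans (perm_to_rem xl) _.
by rewrite /= perm_cons.
Qed.

Lemma sum_nseq (F : nat -> nat) (k x : nat) : \sum_(i <- nseq k x) F i = k * F x.
Proof. by rewrite big_nseq iter_addn_0 mulnC. Qed.

Lemma sum_linear (u D : nat) (R : nat -> nat) (l : seq nat) :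
  \sum_(i <- l) (u + D * R i) = size l * u + D * \sum_(i <- l) R i.
Proof.
by rewrite big_split big_distrr /= big_const_seq count_predT iter_addn_0 mulnC.
Qed.

Lemma sum_count_mem (F : nat -> nat) (m : nat) (l : seq nat) :
  all (fun i => i < m) l ->
  \sum_(i <- l) F i = \sum_(j < m) count_mem (val j) l * F j.
Proof.
elim: l => [_|i l IH /= /andP[im lm]].
  by rewrite big_nil big1.
rewrite big_cons IH// (eq_bigr (fun j : 'I_m =>
    (i == j) * F j + count_mem (val j) l * F j)); last first.
  by move=> j _; rewrite mulnDl.
rewrite big_split /=; congr (_ + _); rewrite (bigD1 (Ordinal im))//= eqxx mul1n.
rewrite big1 ?addn0// => j.
by rewrite -val_eqE /= eq_sym => /negPf->.
Qed.

(** * Reduction to normal form *)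

(* Each reduction decreases the weight, or keeps it and decreases the sum of
   the indices.  Index [0] may occur: since [R_0 = 0] it has weight 0. *)
Lemma normal_form (a m q k : nat) (l : seq nat) :
  2 <= a -> 0 < q -> 0 < m -> q <= repunit a m -> repunit a m <= q + k ->
  exists l', [/\
    \sum_(i <- l') (q + k * repunit a i) = \sum_(i <- l) (q + k * repunit a i),
    all (fun i => i < m) l',
    residual_on a m.-1 (fun j => count_mem j.+1 l') &
    \sum_(i <- l') repunit a i < q].
Proof.
move=> a2 q0 m0 qm mqk.
have [N] := ubnP (\sum_(i <- l) repunit a i).
elim: N l => // N IHN l; rewrite ltnS => lN.
have [K] := ubnP (\sum_(i <- l) i).
elim: K l lN => // K IHK l lN; rewrite ltnS => lK.
have reduce l' : \sum_(i <- l') (q + k * repunit a i) =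
    \sum_(i <- l) (q + k * repunit a i) ->
    \sum_(i <- l') repunit a i < \sum_(i <- l) repunit a i ->
    exists l', [/\
      \sum_(i <- l') (q + k * repunit a i) =
        \sum_(i <- l) (q + k * repunit a i),
      all (fun i => i < m) l',
      residual_on a m.-1 (fun j => count_mem j.+1 l') &
      \sum_(i <- l') repunit a i < q].
  by move=> <- l'l; apply: IHN; rewrite (leq_trans l'l).
have [lm|/allPn [j jl]] := boolP (all (fun i => i < m) l); last first.
  (* [s_j = s_(j-m) + a^(j-m) (x s_1 + (k - x) s_0)], where [R_m = q + x] *)
  rewrite -leqNgt => mj; have pl := perm_to_rem jl.
  move: qm mqk; set x := repunit a m - q => qm mqk.
  apply: (reduce ((j - m) :: nseq (a ^ (j - m) * (k - x)) 0 ++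
                  nseq (a ^ (j - m) * x) 1 ++ rem j l)).
    rewrite (perm_big _ pl) /= !big_cons !big_cat /= !sum_nseq.
    rewrite -[in repunit a j](subnKC mj) repunitD repunit0 repunit1.
    have Rm : repunit a m = q + x by rewrite subnKC.
    have -> : k = x + (k - x) by rewrite subnKC// leq_subLR.
    by rewrite addKn Rm; ring.
  rewrite (perm_big _ pl) /= !big_cons !big_cat /= !sum_nseq.
  rewrite -[in repunit a j](subnKC mj) repunitD repunit0 repunit1.
  have Rm : repunit a m = q + x by rewrite subnKC.
  (* The weight drops by exactly [a^(j-m) q], which is positive. *)
  have A0 : 0 < a ^ (j - m) by rewrite expn_gt0 ltnW.
  have := leq_mul A0 q0; rewrite Rm mulnDr; lia.
(* The exchange [a R_j + R_i = R_(j+1) + a R_(i-1)] consumes [a] copies of [j] and one of [i]; the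
   term [(i == j)] asks for a further copy when the two indices coincide. *)
have [[i [j [i0 ij jl il]]]|nE] := pselect (exists i j, [/\ 0 < i, i <= j,
    a + (i == j) <= count_mem j l & 0 < count_mem i l]).
  have [l1 pl1] := perm_nseq_cat (leq_trans (leq_addr _ _) jl).
  have il1 : i \in l1.
    rewrite -has_pred1 has_count; move: jl il.
    rewrite !(permP pl1) !count_cat !count_nseq /= eqxx.
    by have [->|ij'] := eqVneq i j; rewrite /= ?eqxx 1?eq_sym ?(negPf ij'); lia.
  have pl : perm_eq l (nseq a j ++ i :: rem i l1).
    by rewrite (perm_trans pl1)// perm_cat2l perm_to_rem.
  case: i i0 {il1 jl il} ij pl => // i _ ij pl.
  have [] := IHK (j.+1 :: nseq a i ++ rem i.+1 l1).
  - move: lN; rewrite (perm_big _ pl) !big_cat !big_cons big_cat /= !sum_nseq.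
    by rewrite !repunitS; lia.
  (* With [i] now standing for the predecessor of the old index, the sum of the indices drops by
     [(a - 1)(j - i)]. *)
  - move: lK; rewrite (perm_big _ pl) !big_cat !big_cons big_cat /= !sum_nseq.
    by have := leq_mul (a2 : 1 < a) ij; nia.
  move=> l' [l'E l'm l'r l'q]; exists l'; split=> //; rewrite l'E.
  rewrite (perm_big _ pl) !big_cat !big_cons big_cat /= !sum_nseq !repunitS.
  by ring.
(* When no exchange applies, the case [i = j] bounds each multiplicity by [a], and the case [i < j]
   gives zeros below a multiplicity [a]. *)
have rl : residual_on a m.-1 (fun j => count_mem j.+1 l).
  split=> [i im|i j ij jm ja].
    rewrite leqNgt; apply/negP => ai; apply: nE; exists i.+1, i.+1.
    by split=> //; [rewrite eqxx addn1|exact: leq_trans ai].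
  apply/eqP; rewrite -leqn0 leqNgt; apply/negP => i0; apply: nE.
  exists i.+1, j.+1; split=> //; first by rewrite ltnS ltnW.
  by rewrite ja eqSS ltn_eqF// addn0.
have [lq|ql] := ltnP (\sum_(i <- l) repunit a i) q; first by exists l.
move: (residual_value_lt rl); rewrite prednK// => lRm.
have lE : \sum_(i <- l) repunit a i =
    \sum_(j < m.-1) count_mem j.+1 l * repunit a j.+1.
  rewrite (sum_count_mem _ lm) -[in LHS](prednK m0) big_ord_recl /= repunit0.
  by rewrite muln0.
(* Now [q + z < R_m <= q + k], and a weight [z <= k] is [z] copies of [s_1]. *)
set z := \sum_(i <- l) repunit a i - q.
have zk : z <= k by rewrite leq_subLR lE; exact/ltnW/(leq_trans lRm).
(* The new list has [size l + k] entries and weight [z]: the [k] extra entries, each worth [q], pay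
   for the lost weight [q], each unit of which is worth [k]. *)
apply: (reduce (nseq (size l + (k - z)) 0 ++ nseq z 1)).
  rewrite [in RHS]sum_linear big_cat /= !sum_nseq repunit0 repunit1.
  have -> : \sum_(i <- l) repunit a i = q + z by rewrite subnKC.
  by rewrite -[in RHS](subnKC zk) -[in X in _ + X](subnKC zk); ring.
rewrite big_cat /= !sum_nseq repunit0 repunit1 /z.
by rewrite muln0 muln1 add0n ltn_subrL q0 (leq_trans q0).
Qed.

(** * The generators of [S_n] and their gcd *)

Lemma submonoid_gen_range (f : nat -> nat) :
  submonoid_gen (range f) = [set \sum_(i <- l) f i | l in [set: seq nat]].
Proof.
apply/seteqP; split.
  apply: smallest_sub.
    split; first by exists [::]; rewrite ?big_nil.
    by move=> _ _ [l1 _ <-] [l2 _ <-]; exists (l1 ++ l2); rewrite ?big_cat.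
  by move=> _ [i _ <-]; exists [:: i]; rewrite ?big_seq1.
move=> _ [l _ <-] M [[M0 MD] fM]; apply: (big_ind M) => // i _.
by apply: fM; exists i.
Qed.

Lemma s_repunit (a c : nat) (d : int) (n j : nat) :
  2 <= a -> 1 <= n -> (d < c%:Z * a%:Z)%R ->
  s a c d n j = s a c d n 0 + c * a ^ n * (a - 1) * repunit a j.
Proof.
move=> a2 n1 hd; have [_ E0] := sE 0 a2 n1 hd; have [_ Ej] := sE j a2 n1 hd.
have H : c * a ^ (n + j) = c * a ^ n + c * a ^ n * (a - 1) * repunit a j.
  by rewrite expnD -(repunit_subn1 j (ltnW a2)); ring.
have PX k : (Posz (a ^ k) = Posz a ^+ k)%R by rewrite -natrXE rmorphXn.
have /(congr1 Posz) := H; rewrite PoszD 2!PoszM !PX => HZ.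
apply/eqP; rewrite -eqz_nat PoszD Ej E0 HZ addn0; apply/eqP.
by rewrite addrAC.
Qed.

(** A common divisor divides [f 0 = u] and [f 1 = u + D], hence [D] too. *)
Lemma set_gcd_submonoid_gen (f : nat -> nat) (u D : nat) (r : nat -> nat) :
  r 0 = 0 -> r 1 = 1 -> (forall j, f j = u + D * r j) ->
  set_gcd (submonoid_gen (range f)) = gcdn u D.
Proof.
move=> r0 r1 fE; set S := submonoid_gen _.
have gP : is_set_gcd S (gcdn u D).
  rewrite /S submonoid_gen_range; split.
    move=> _ [l _ <-]; apply: (big_ind (dvdn _)) => [||i _].
    - exact: dvdn0.
    - by move=> x y; exact: dvdn_add.
    - by rewrite fE dvdn_add ?dvdn_gcdl// dvdn_mulr// dvdn_gcdr.
  move=> h hS; have hf j : h %| f j.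
    by apply: hS; exists [:: j]; rewrite ?big_seq1.
  have hu : h %| u by have := hf 0; rewrite fE r0 muln0 addn0.
  have := hf 1; rewrite fE r1 muln1 dvdn_addr// => hD.
  by rewrite dvdn_gcd hu.
apply: xget_unique => // g [g1 g2]; apply/eqP.
by rewrite eqn_dvd gP.2// g2//; exact: gP.1.
Qed.

(** * Determination of the Apéry set *)

Theorem theorem4p7 (a c : nat) (d : int) (n m lambda : nat)
  (alpha : (m.-1).-tuple nat)
  (ha : 2 <= a) (hc : 0 < c) (hd : (d < c%:Z * a%:Z)%R)
  (hda : (gcdz d a%:Z = 1)%R) (hdc : (gcdz d c%:Z = 1)%R) (hn : 1 <= n)
  (hm : m = embdim (S_ a c d n)) (hm2 : 2 <= m)
  (hlambda : lambda = set_gcd (S_ a c d n))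
  (halpha : residual a alpha)
  (hs0 : s a c d n 0 %/ lambda =
         1 + \sum_(j < m.-1) tnth alpha j * repunit a j.+1)
  (hRm : repunit a m <= s a c d n 1 %/ lambda) :
  apery (S_ a c d n) (s a c d n 0) =
  [set \sum_(j < m.-1) tnth beta j * s a c d n j.+1 |
     beta in [set beta : (m.-1).-tuple nat |
                residual a beta /\ colex_le beta alpha]].
Proof.
have m0 : 0 < m by rewrite ltnW.
have [s0_gt0 _] := sE 0 ha hn hd.
pose D := c * a ^ n * (a - 1).
have sR j : s a c d n j = s a c d n 0 + D * repunit a j by exact: s_repunit.
have lE : lambda = gcdn (s a c d n 0) D.
  rewrite hlambda; apply: set_gcd_submonoid_gen sR.
    exact: repunit0.
  exact: repunit1.
pose q := s a c d n 0 %/ lambda; pose k := D %/ lambda.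
have l0 : 0 < lambda by rewrite lE gcdn_gt0 s0_gt0.
have s0q : s a c d n 0 = lambda * q by rewrite mulnC divnK// lE dvdn_gcdl.
have Dk : D = lambda * k by rewrite mulnC divnK// lE dvdn_gcdr.
have qk : coprime q k.
  rewrite /coprime -(eqn_pmul2l l0) muln_gcdr -s0q -Dk -lE muln1.
  by rewrite eqxx.
have s_mul j : s a c d n j = lambda * (q + k * repunit a j).
  by rewrite sR Dk s0q mulnDr mulnA.
have sums (l : seq nat) : \sum_(i <- l) s a c d n i =
    lambda * \sum_(i <- l) (q + k * repunit a i).
  by rewrite big_distrr; apply: eq_bigr.
rewrite -/q in hs0.
have q0 : 0 < q by rewrite hs0.
have qm : q <= repunit a m.
  rewrite hs0 add1n -[X in repunit a X](prednK m0).
  have := residual_value_lt (residual_tnth halpha).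
  by under eq_bigr do rewrite -tnth_nth.
have mqk : repunit a m <= q + k.
  by move: hRm; rewrite s_mul repunit1 muln1 mulKn.
(* The weight of [alpha] is [q - 1], so the colexicographic bound becomes weight less than [q]. *)
have colexE (b : m.-1.-tuple nat) : residual a b ->
    colex_le b alpha <-> \sum_(j < m.-1) tnth b j * repunit a j.+1 < q.
  by move=> rb; rewrite (colex_leP rb halpha) hs0 add1n ltnS.
have nf x : S_ a c d n x -> exists y b, [/\ residual a b,
    \sum_(j < m.-1) tnth b j * repunit a j.+1 < q &
    x = y * s a c d n 0 + \sum_(j < m.-1) tnth b j * s a c d n j.+1].
  rewrite /S_ submonoid_gen_range => -[l _ <-].
  have [l' [l'l l'm [ra r0] l'q]] := normal_form l ha q0 m0 qm mqk.
  have split0 F : \sum_(i <- l') F i = count_mem 0 l' * F 0 +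
      \sum_(j < m.-1) count_mem j.+1 l' * F j.+1.
    rewrite (sum_count_mem F l'm) -[in LHS](prednK m0) big_ord_recl /=.
    by congr (_ + _); apply: eq_bigr.
  pose b := [tuple count_mem j.+1 l' | j < m.-1].
  have bE F : \sum_(j < m.-1) tnth b j * F j.+1 =
      \sum_(j < m.-1) count_mem j.+1 l' * F j.+1.
    by apply: eq_bigr => j _; rewrite tnth_mktuple.
  exists (count_mem 0 l'), b; split.
  - split=> [i|j j0 + i ij]; rewrite !tnth_mktuple; first exact: ra.
    exact: r0.
  - by move: l'q; rewrite bE split0 repunit0 muln0.
  - by rewrite bE -split0 !sums l'l.
have Sb y (b : m.-1.-tuple nat) : S_ a c d n
    (y * s a c d n 0 + \sum_(j < m.-1) tnth b j * s a c d n j.+1).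
  rewrite /S_ => M [[M0 MD] sM].
  have MM z j : M (z * s a c d n j).
    elim: z => [|z IH]; first by rewrite mul0n.
    by rewrite mulSn; apply: MD => //; apply: sM; exists j.
  by apply: (MD) => //; apply: (big_ind M) => // j _; exact: MM.
apply/seteqP; split=> [x [/nf[y [b [rb bq ->]]] nx]|_ [b [rb ba] <-]].
  exists b; first by split=> //; exact/colexE.
  (* A positive multiple of [s_0] in the normal form would leave [x - s_0] in [S_n]. *)
  case: y nx => [//|y] nx; exfalso; apply: nx.
  rewrite mulSn -addnA leq_addr addKn; split=> //.
have bq := (colexE b rb).1 ba.
split; first by have := Sb 0 b; rewrite mul0n.
(* Conversely, the normal form of the difference with [s_0] yields [b']; proving [b = b'] forces the
   absurd [y.+1 * s_0 = 0]. *)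
move=> [s0b /nf[y [b' [rb' b'q E]]]].
have {}E : \sum_(j < m.-1) tnth b j * s a c d n j.+1 = y.+1 * s a c d n 0 +
    \sum_(j < m.-1) tnth b' j * s a c d n j.+1.
  by rewrite mulSn -addnA -E subnKC.
have valE (t : m.-1.-tuple nat) : \sum_(j < m.-1) tnth t j * s a c d n j.+1 =
    lambda * ((\sum_(j < m.-1) tnth t j) * q +
      k * \sum_(j < m.-1) tnth t j * repunit a j.+1).
  rewrite big_distrl big_distrr -big_split big_distrr /=.
  by apply: eq_bigr => j _; rewrite s_mul; ring.
suff bb' : b = b'.
  move: E; rewrite bb' => /eqP; rewrite -[X in X == _]add0n eqn_add2r.
  by rewrite eq_sym muln_eq0 (gtn_eqF s0_gt0).
apply: (residual_value_inj rb rb').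
(* Both weights are below [q], so a congruence modulo [q] suffices. It comes from [E] divided by
   [lambda], with [k] cancelled because it is coprime to [q]. *)
rewrite -(modn_small bq) -[RHS](modn_small b'q); apply/eqP.
move: E; rewrite !valE s0q mulnCA -mulnDr => /eqP.
rewrite eqn_pmul2l// addnA -mulnDl => /eqP /(congr1 (modn^~ q)).
rewrite /= !modnMDl => /eqP.
move: (\sum_(j < _) _) (\sum_(j < _) _) => B A.
(* The weights are ordered first because the congruence is turned into divisibility of a truncated
   difference. *)
wlog le_BA : A B / B <= A.
  move=> W; have [BA|/ltnW AB] := leqP B A; first exact: W.
  by rewrite eq_sym => /(W _ _ AB); rewrite eq_sym.
rewrite !eqn_mod_dvd ?leq_mul2l ?le_BA ?orbT//.
by rewrite -mulnBr Gauss_dvdr.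
Qed.
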